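(* Let $(n_i)_{i\ge 1}$ be a sequence of positive integers and let $B^{(i)} \subset \{-1,1\}^{n_i}$ for each $i$. The sequence $(B^{(i)})$ is noise stable if and only if there exist $t > 0$ and $\epsilon > 0$ such that, for all sufficiently large $i$, $M(B^{(i)}_Z) \ge \epsilon$ with probability at least $\epsilon$, where $Z$ is distributed on $\{-1,0,1\}^{n_i}$ according to $\mu_t$.
   Context: $\{-1,1\}^n$ carries the uniform probability measure, with respect to which $\mathbb{E}$, $\mathrm{Var}$, $\mathrm{Cov}$ of functions on the cube are taken. For $t \ge 0$, $P_t$ is the Bonami-Beckner semigroup: for $n=1$, $(P_{t,1} f)(x) = \mathbb{E} f + e^{-t}(f(x) - \mathbb{E} f)$, and in general $P_t = P_{t,1}^{\otimes n}$. A sequence of sets $A_i \subset \{-1,1\}^{n_i}$ is noise sensitive if for every $t>0$, $\mathrm{Var}(P_t 1_{A_i}) \to 0$ as $i \to \infty$; otherwise the sequence is called noise stable. A half-space in $\{-1,1\}^n$ is a set of the form $\{x \in \{-1,1\}^n : \langle x, a\rangle \le b\}$ with $a \in \mathbb{R}^n$, $b \in \mathbb{R}$; $\mathcal{H}_n$ is the set of all half-spaces. For $B \subset \{-1,1\}^n$, $M(B) = \sup_{A \in \mathcal{H}_n} \mathrm{Cov}(1_A, 1_B)$. For $z \in \{-1,0,1\}^n$ and $y \in \{-1,1\}^n$, $z \oslash y \in \{-1,1\}^n$ is defined by $(z \oslash y)_i = y_i$ if $z_i = 0$ and $(z\oslash y)_i = z_i$ otherwise. The restriction of $B \subset \{-1,1\}^n$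 by $z$ is $B_z = \{x \in \{-1,1\}^n : z \oslash x \in B\}$. $\mu_t$ is the probability measure on $\{-1,0,1\}^n$ under which the coordinates are independent, each equal to $0$ with probability $e^{-t}$ and otherwise chosen uniformly from $\{-1,1\}$.
   Formalization: As stated it fails (dictators for even i, empty sets for odd i); proved instead: noise stable iff for some t, ε > 0 the condition holds for infinitely many i, and every subsequence is noise stable iff for some t, ε > 0 it holds for all sufficiently large i. *)

(* Defs.v *)
From HB Require Import structures.
From mathcomp Require Import all_boot all_order all_algebra.
From mathcomp Require Import all_classical all_reals all_analysis.

Set Implicit Arguments.
Unset Strict Implicit.
Unset Printing Implicit Defensive.

Import Order.TTheory GRing.Theory Num.Theory.
Import numFieldNormedType.Exports.

Local Open Scope ring_scope.

(* A point of {-1,1} is a bool, b standing for (-1) ^+ b; a point of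
   {-1,0,1} is an option bool, None standing for 0. *)
Definition pm1 {R : realType} (b : bool) : R := (-1) ^+ b.

Definition cube (n : nat) : finType := {ffun 'I_n -> bool}.

Definition tcube (n : nat) : finType := {ffun 'I_n -> option bool}.

(* Mean, variance and covariance for the uniform measure on a finite type. *)
Section Uniform.
Context {R : realType} {T : finType}.
Implicit Types (f g : T -> R).

Definition mean f : R := (\sum_x f x) / #|T|%:R.

Definition cov f g : R := mean (fun x => (f x - mean f) * (g x - mean g)).

Definition var f : R := cov f f.

Definition ind (A : {set T}) (x : T) : R := (x \in A)%:R.

End Uniform.

Definition noise1 {R : realType} (t : R) (f : bool -> R) (x : bool) : R :=
  mean f + expR (- t) * (f x - mean f).

(* The n-th tensor power of noise1 t, through its matrix: the (x, y) entry of
   noise1 t is the value at x of its image of the indicator of y, and the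
   entries of a tensor power are the products of entries. *)
Definition noise {R : realType} {n : nat} (t : R) (f : cube n -> R)
    (x : cube n) : R :=
  \sum_(y : cube n) (\prod_(i < n) noise1 t (ind [set y i]) (x i)) * f y.

(* The sets B i, for i : nat, live in cubes of varying dimension n i. *)
Definition noise_sensitive (R : realType) (n : nat -> nat)
    (B : forall i, {set cube (n i)}) : Prop :=
  forall t : R, 0 < t ->
    ((fun i => var (noise t (ind (B i)))) @ \oo --> (0 : R))%classic.

Definition noise_stable (R : realType) (n : nat -> nat)
    (B : forall i, {set cube (n i)}) : Prop :=
  ~ noise_sensitive R B.

Definition halfspaces (R : realType) (n : nat) : set {set cube n} :=
  [set A : {set cube n} | exists (a : 'I_n -> R) (b : R),
    forall x, x \in A = (\sum_(i < n) pm1 (x i) * a i <= b)]%classic.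

Arguments halfspaces R n : clear implicits.

(* The supremum is over a nonempty finite set of reals. *)
Definition maxcov (R : realType) (n : nat) (B : {set cube n}) : R :=
  sup [set cov (ind A) (ind B) | A in halfspaces R n]%classic.

Definition oslash {n : nat} (z : tcube n) (y : cube n) : cube n :=
  [ffun i => if z i is Some b then b else y i].

Definition zrestrict {n : nat} (B : {set cube n}) (z : tcube n) : {set cube n} :=
  [set x | oslash z x \in B].

(* The mass function of mu_t, a nonzero value of a coordinate having
   probability (1 - e^-t) / 2. *)
Definition mu {R : realType} {n : nat} (t : R) (z : tcube n) : R :=
  \prod_(i < n) (if z i is Some _ then (1 - expR (- t)) / 2 else expR (- t)).

Definition mu_prob {R : realType} {n : nat} (t : R) (E : pred (tcube n)) : R :=
  \sum_(z | E z) mu t z.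

(* "M(B_Z) >= eps with probability at least eps", Z being distributed
   according to mu_t. *)
Definition restr_correlated {R : realType} {n : nat} (t eps : R)
    (B : {set cube n}) : Prop :=
  eps <= mu_prob t (fun z => eps <= maxcov R (zrestrict B z)).

(* Main.v *)
Require Import Defs.
From mathcomp Require Import all_boot all_order all_algebra.
From mathcomp Require Import all_classical all_reals all_analysis.
From mathcomp Require Import ring lra.

Set Implicit Arguments.
Unset Strict Implicit.
Unset Printing Implicit Defensive.

Import Order.TTheory GRing.Theory Num.Theory.
Import numFieldNormedType.Exports.

Local Open Scope ring_scope.

(** The proof is quantitative in both directions, with constants that do not
    depend on the dimension.  Write [p = exp (- t)] for the probability that a
    coordinate survives the restriction.

    Everything quadratic is a diagonal form in the Walsh basis, and equally a
    double sum against a product kernel ([qformE]).  The variance of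
    [noise t f] gives the character [S] the weight [exp (- 2 t #|S|)], for [S]
    nonempty ([var_noise]), and averaging over a restriction acts on the kernel
    one coordinate at a time ([mu_qform]).

    From stability to correlation: stability puts weight on low levels.  Under a
    restriction a character of level [k] becomes a single coordinate with
    probability [k * p * (1 - p) ^+ (k - 1)], so the restricted functions have
    level-one weight bounded below on average ([mu_weight1_ge]).  A function with
    level-one weight [w] correlates with the linear form [L] given by its
    level-one coefficients; as [E L ^+ 2 = w], the form is, up to a controlled
    error, an average of indicators of half-spaces [L >= c], and one of these has
    covariance at least [w / 2] ([half_weight1_le_maxcov]).  Markov's inequality
    turns the average over restrictions into a probability
    ([restr_correlated_noise]).

    From correlation to stability: half-spaces are noise stable uniformly in the
    dimension.  Following Peres, noise at flip rate [1 / m] on a half-space is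
    the average influence of a random half-space in dimension [m]
    ([halfspace_noise]), and the total influence there is at most
    [2 * sqrt m] ([halfspace_influence]).  Hence a function correlated with a
    half-space keeps some variance under a small noise [u]
    ([var_noise_ge_of_cov]).  Restriction followed by the noise [u] is dominated
    by the noise [s] with [exp (- 2 s) = 1 - p + p * exp (- 2 u)], so the
    original function keeps variance under [s] ([mu_var_noise_le]).

    The statement for infinitely many indices is then immediate.  For the one
    about all large indices, a failure for every pair of parameters is
    diagonalised into a subsequence: since stability at any noise time yields
    correlation at every large restriction time, letting the restriction time
    tend to infinity along the subsequence makes it sensitive at all noise
    times at once. *)

(** * Averages on a finite type *)

Section Averages.
Context {R : realType} {T : finType}.
Implicit Types (f g h : T -> R).

Lemma eq_mean f g : f =1 g -> mean f = mean g.
Proof. by move=> fg; rewrite /mean (eq_bigr g). Qed.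

Lemma meanD f g : mean (fun x => f x + g x) = mean f + mean g.
Proof. by rewrite /mean big_split mulrDl. Qed.

Lemma meanZ c f : mean (fun x => c * f x) = c * mean f.
Proof. by rewrite /mean -mulr_sumr mulrA. Qed.

Lemma meanB f g : mean (fun x => f x - g x) = mean f - mean g.
Proof. by rewrite /mean sumrB mulrBl. Qed.

Lemma mean_sum (J : Type) (r : seq J) (P : pred J) (F : J -> T -> R) :
  mean (fun x => \sum_(j <- r | P j) F j x) = \sum_(j <- r | P j) mean (F j).
Proof. by rewrite /mean exchange_big mulr_suml. Qed.

Lemma ler_mean f g : (forall x, f x <= g x) -> mean f <= mean g.
Proof. by move=> fg; rewrite ler_wpM2r ?invr_ge0// ler_sum. Qed.

Lemma mean_cst (c : R) : (0 < #|T|)%N -> mean (fun _ : T => c) = c.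
Proof.
by move=> T0; rewrite /mean sumr_const -[c *+ _]mulr_natr mulfK// pnatr_eq0 -lt0n.
Qed.

Lemma mean_ge0 f : (forall x, 0 <= f x) -> 0 <= mean f.
Proof. by move=> f0; rewrite mulr_ge0 ?invr_ge0// sumr_ge0. Qed.

Lemma mean_reindex (h : T -> T) f : bijective h -> mean (f \o h) = mean f.
Proof. by move=> bh; rewrite /mean [in RHS](reindex h) //; apply: onW_bij. Qed.

Context (T0 : (0 < #|T|)%N).

Lemma covE f g : cov f g = mean (fun x => f x * g x) - mean f * mean g.
Proof.
rewrite /cov; under eq_mean => x.
  rewrite (_ : _ * _ = f x * g x + mean f * mean g - mean f * g x - mean g * f x);
    last by ring.
  over.
by rewrite !meanB meanD mean_cst// !meanZ; ring.
Qed.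

Lemma varE f : var f = mean (fun x => f x ^+ 2) - mean f ^+ 2.
Proof. exact: covE. Qed.

Lemma mean_le_cst f c : (forall x, f x <= c) -> mean f <= c.
Proof. by move=> /ler_mean; rewrite mean_cst. Qed.

Lemma ind_itv (A : {set T}) x : 0 <= (ind A x : R) <= 1.
Proof. by rewrite /ind; case: (x \in A); rewrite ?lexx ?ler01. Qed.

Lemma cov_le1 (A B : {set T}) : cov (ind A) (ind B) <= 1 :> R.
Proof.
rewrite covE.
have AB : mean (fun x => ind A x * ind B x) <= 1 :> R.
  apply: mean_le_cst => x; have /andP[a0 a1] := ind_itv A x.
  by have /andP[b0 b1] := ind_itv B x; nra.
have A0 : 0 <= mean (ind A) :> R.
  by apply: mean_ge0 => x; case/andP: (ind_itv A x).
have B0 : 0 <= mean (ind B) :> R.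
  by apply: mean_ge0 => x; case/andP: (ind_itv B x).
by nra.
Qed.

(** Averaging [(lam * (f - mean f) - (g - mean g)) ^+ 2 >= 0] is Cauchy-Schwarz
    with the square root traded for a free parameter. *)
Lemma cov_le_var f g lam :
  2 * lam * cov f g <= lam ^+ 2 * var f + var g.
Proof.
have : 0 <= mean (fun x => (lam * (f x - mean f) - (g x - mean g)) ^+ 2).
  by apply: mean_ge0 => x; exact: sqr_ge0.
under eq_mean => x.
  rewrite (_ : _ ^+ 2 = lam ^+ 2 * ((f x - mean f) * (f x - mean f))
    + (g x - mean g) * (g x - mean g)
    - 2 * lam * ((f x - mean f) * (g x - mean g))); last by ring.
  over.
by rewrite meanB meanD !meanZ -!/(cov _ _) -!/(var _) subr_ge0.
Qed.

End Averages.

(** * Product weights *)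

Section ProductSums.
Context {R : realType}.

Lemma sum_cube_prod n (F : 'I_n -> bool -> R) :
  \sum_(x : cube n) \prod_i F i (x i) = \prod_i (F i true + F i false).
Proof.
under [RHS]eq_bigr => i _ do rewrite -(big_bool _ (F i)).
by rewrite bigA_distr_bigA.
Qed.

Lemma sum_optb (F : option bool -> R) :
  \sum_c F c = F None + (F (Some true) + F (Some false)).
Proof.
rewrite (bigD1 None)// (bigD1 (Some true))// (bigD1 (Some false))//=.
by rewrite big_pred0 ?addr0// => -[[]|].
Qed.

Lemma prod_natb n (P : pred 'I_n) :
  \prod_(i < n) (P i)%:R = [forall i, P i]%:R :> R.
Proof.
have [/forallP allP|] := boolP [forall i, P i].
  by rewrite big1// => i _; rewrite allP.
rewrite negb_forall => /existsP[i Pi].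
by rewrite (bigD1 i)//= (negbTE Pi) mul0r.
Qed.

(** Sums over the points of a restricted cube and over assignments of coordinates
    to blocks have this shape; the push-forward reduces both to a computation at
    a single coordinate. *)
Lemma push_prod n (J K : finType) (w : 'I_n -> J -> R) (h : 'I_n -> J -> K)
    (F : {ffun 'I_n -> K} -> R) :
  \sum_(p : {ffun 'I_n -> J}) (\prod_i w i (p i)) * F [ffun i => h i (p i)] =
  \sum_(y : {ffun 'I_n -> K}) (\prod_i \sum_k w i k * (y i == h i k)%:R) * F y.
Proof.
under [RHS]eq_bigr => y _ do rewrite bigA_distr_bigA mulr_suml.
rewrite exchange_big; apply: eq_bigr => p _ /=.
under [RHS]eq_bigr => y _ do rewrite /= big_split prod_natb -mulrA /=.
rewrite -mulr_sumr; congr (_ * _).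
rewrite (bigD1 [ffun i => h i (p i)])//= [X in _ + X]big1 ?addr0.
  by rewrite (_ : [forall i, _] = true) ?mul1r//; apply/forallP => i; rewrite ffunE.
move=> y; case: forallP => [yh|]; last by rewrite mul0r.
by case/eqP; apply/ffunP => i; rewrite ffunE; apply/eqP/yh.
Qed.

End ProductSums.

(** * Linear forms and Walsh coefficients on the cube *)

Lemma card_cube_gt0 n : (0 < #|cube n|)%N.
Proof. by rewrite card_ffun card_bool expn_gt0. Qed.
#[local] Hint Resolve card_cube_gt0 : core.

Section Cube.
Context {R : realType} {n : nat}.
Implicit Types (f g : cube n -> R) (x y : cube n).

Lemma pm1M (a b : bool) : pm1 (a (+) b) = pm1 a * pm1 b :> R.
Proof. by case: a b => -[]; rewrite /pm1 /=; ring. Qed.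

Lemma pm1_sqr (b : bool) : pm1 b * pm1 b = 1 :> R.
Proof. by case: b; rewrite /pm1 /=; ring. Qed.

Definition flip (D : pred 'I_n) x : cube n := [ffun i => x i (+) D i].

Lemma flipK D : involutive (flip D).
Proof. by move=> x; apply/ffunP => i; rewrite !ffunE -addbA addbb addbF. Qed.

Lemma mean_flip D f : mean (fun x => f (flip D x)) = mean f.
Proof. exact: (mean_reindex f (inv_bij (flipK D))). Qed.

Lemma mean_pm1 (i : 'I_n) : mean (fun x : cube n => pm1 (x i)) = 0 :> R.
Proof.
set c := mean _; suff : c = - c by lra.
rewrite {1}/c -(mean_flip (pred1 i)) -mulN1r -meanZ; apply: eq_mean => x.
by rewrite ffunE /= eqxx pm1M /pm1 expr1 mulrC.
Qed.

Lemma mean_pm1M (i j : 'I_n) :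
  mean (fun x : cube n => pm1 (x i) * pm1 (x j)) = (i == j)%:R :> R.
Proof.
have [->|ij] := eqVneq i j.
  by under eq_mean do rewrite pm1_sqr; rewrite mean_cst.
set c := mean _; suff : c = - c by rewrite /=; lra.
rewrite {1}/c -(mean_flip (pred1 i)) -mulN1r -meanZ; apply: eq_mean => x.
by rewrite !ffunE /= eqxx eq_sym (negbTE ij) addbF pm1M /pm1 expr1; ring.
Qed.

Definition lin (a : 'I_n -> R) x : R := \sum_i pm1 (x i) * a i.

Lemma mean_lin a : mean (lin a) = 0.
Proof.
rewrite /lin mean_sum big1// => i _.
under eq_mean => x do rewrite mulrC.
by rewrite meanZ mean_pm1 mulr0.
Qed.

Lemma mean_lin_sqr a : mean (fun x => lin a x ^+ 2) = \sum_i a i ^+ 2.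
Proof.
under eq_mean => x do rewrite expr2 {1}/lin mulr_suml.
rewrite mean_sum; apply: eq_bigr => i _.
under eq_mean => x do rewrite /lin mulr_sumr.
rewrite mean_sum (bigD1 i)//= big1 ?addr0 => [|j ji].
  under eq_mean => x.
    rewrite (_ : _ * _ = a i ^+ 2 * (pm1 (x i) * pm1 (x i))); last by ring.
    over.
  by rewrite meanZ mean_pm1M eqxx mulr1.
under eq_mean => x.
  rewrite (_ : _ * _ = (a i * a j) * (pm1 (x i) * pm1 (x j))); last by ring.
  over.
by rewrite meanZ mean_pm1M eq_sym (negbTE ji) mulr0.
Qed.

Definition walsh (S : {set 'I_n}) x : R := \prod_(i in S) pm1 (x i).

Definition fcoef f S : R := mean (fun x => f x * walsh S x).

(** The diagonal form in the Walsh basis whose multiplier is the tensor product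
    of [diag (al i, be i)].  The second moments and variances below are such forms
    or differences of two of them. *)
Definition qform f (al be : 'I_n -> R) : R :=
  \sum_(S : {set 'I_n}) (\prod_i (if i \in S then be i else al i)) * fcoef f S ^+ 2.

Lemma qformE f al be : qform f al be =
  (#|cube n|%:R ^- 2) * \sum_x \sum_y f x * f y *
    \prod_i (al i + be i * (pm1 (x i) * pm1 (y i))).
Proof.
have prodE (S : {set _}) x y :
    \prod_i (if i \in S then be i * (pm1 (x i) * pm1 (y i)) else al i) =
    (\prod_i (if i \in S then be i else al i)) * (walsh S x * walsh S y).
  rewrite /walsh [\prod_(i in S) pm1 (x i)]big_mkcond.
  rewrite [\prod_(i in S) pm1 (y i)]big_mkcond -!big_split.
  by apply: eq_bigr => i _ /=; case: ifP; rewrite ?mulr1.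
under [in RHS]eq_bigr => x _.
  under eq_bigr => y _.
    under eq_bigr => i _ do rewrite addrC.
    rewrite bigA_distr mulr_sumr.
    under eq_bigr => S _ do rewrite prodE.
    over.
  rewrite exchange_big.
  over.
rewrite exchange_big mulr_sumr; apply: eq_bigr => S _ /=.
rewrite /fcoef /mean expr_div_n mulrA mulrC; congr (_ * _).
rewrite expr2 mulr_suml mulr_sumr; apply: eq_bigr => x _.
rewrite mulr_sumr mulr_sumr; apply: eq_bigr => y _.
by ring.
Qed.

End Cube.

(** * Noise in the Walsh basis *)

Section Spectral.
Context {R : realType} {n : nat}.
Implicit Types (f g : cube n -> R) (t : R).

Lemma qform_le f al be be' : (forall i, 0 <= al i) -> (forall i, 0 <= be i <= be' i) ->
  qform f al be <= qform f al be'.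
Proof.
move=> al0 be0; apply: ler_sum => S _; rewrite ler_wpM2r ?sqr_ge0//.
by apply: ler_prod => i _; case: ifP => _; rewrite ?be0 ?al0 ?lexx.
Qed.

Lemma sqr_meanM f g : mean (fun x => f x * g x) ^+ 2 =
  #|cube n|%:R ^- 2 * \sum_x \sum_y f x * f y * (g x * g y).
Proof.
rewrite /mean expr_div_n mulrC; congr (_ * _); rewrite expr2 mulr_suml.
apply: eq_bigr => x _; rewrite mulr_sumr; apply: eq_bigr => y _.
by ring.
Qed.

Lemma sqr_meanE f : mean f ^+ 2 = qform f (fun=> 1) (fun=> 0).
Proof.
under eq_mean => x do rewrite -[f x]mulr1.
rewrite sqr_meanM qformE; congr (_ * _).
apply: eq_bigr => x _; apply: eq_bigr => y _.
by rewrite big1 ?mulr1// => i _; rewrite mul0r addr0.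
Qed.

Lemma sqr_mean_pm1E f (i : 'I_n) : mean (fun x => f x * pm1 (x i)) ^+ 2 =
  qform f (fun j => (j != i)%:R) (fun j => (j == i)%:R).
Proof.
rewrite sqr_meanM qformE; congr (_ * _).
apply: eq_bigr => x _; apply: eq_bigr => y _; congr (_ * _).
rewrite (bigD1 i)//= eqxx big1 ?mulr1 ?add0r ?mul1r// => j /negbTE->.
by rewrite mul0r addr0.
Qed.

Lemma noise1E t (a b : bool) :
  noise1 t (ind [set b]) a = (1 + expR (- t) * (pm1 a * pm1 b)) / 2.
Proof.
rewrite /noise1 /mean card_bool big_bool /ind !inE /pm1.
by case: a b => -[] /=; field.
Qed.

Definition noise_kernel t (x y : cube n) : R :=
  \prod_i noise1 t (ind [set y i]) (x i).

Lemma noise_kernel_ge0 t x y : 0 <= t -> 0 <= noise_kernel t x y.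
Proof.
move=> t0; apply: prodr_ge0 => i _; rewrite noise1E.
have e0 := expR_gt0 (- t); have e1 : expR (- t) <= 1 by rewrite expR_le1; lra.
by rewrite /pm1; case: (x i) (y i) => -[] /=; lra.
Qed.

Lemma sum_noise_kernel t y : \sum_x noise_kernel t x y = 1.
Proof.
rewrite /noise_kernel (sum_cube_prod (fun i a => noise1 t (ind [set y i]) a)).
rewrite big1// => i _; rewrite !noise1E /pm1.
by case: (y i) => /=; field.
Qed.

Lemma mean_noise t f : mean (noise t f) = mean f.
Proof.
rewrite /mean /noise exchange_big; congr (_ / _); apply: eq_bigr => y _.
by rewrite -mulr_suml -/(noise_kernel _ _ _) sum_noise_kernel mul1r.
Qed.

Lemma card_cubeE : #|cube n|%:R = 2 ^+ n :> R.
Proof. by rewrite card_ffun card_bool card_ord natrX. Qed.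

Lemma mean_noise_sqr t f : mean (fun x => noise t f x ^+ 2) =
  qform f (fun=> 1) (fun=> expR (- t) ^+ 2).
Proof.
rewrite qformE /mean.
transitivity (\sum_y \sum_y' f y * f y' *
    (\sum_x noise_kernel t x y * noise_kernel t x y') / #|cube n|%:R).
  under eq_bigr => x _.
    rewrite expr2 {1}/noise mulr_suml.
    under eq_bigr => y _ do rewrite /noise mulr_sumr.
    over.
  rewrite exchange_big /= mulr_suml; apply: eq_bigr => y _.
  rewrite exchange_big /= mulr_suml; apply: eq_bigr => y' _.
  rewrite mulr_sumr; congr (_ / _); apply: eq_bigr => x _.
  by rewrite -!/(noise_kernel _ _ _); ring.
rewrite mulr_sumr; apply: eq_bigr => y _.
rewrite mulr_sumr; apply: eq_bigr => y' _.
rewrite -mulrA [RHS]mulrCA; congr (_ * _).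
have -> : \sum_x noise_kernel t x y * noise_kernel t x y' =
    \prod_i \sum_a noise1 t (ind [set y i]) a * noise1 t (ind [set y' i]) a.
  rewrite bigA_distr_bigA; apply: eq_bigr => x _.
  by rewrite /noise_kernel -big_split.
suff -> : \prod_i \sum_a noise1 t (ind [set y i]) a * noise1 t (ind [set y' i]) a =
    #|cube n|%:R^-1 * \prod_i (1 + expR (- t) ^+ 2 * (pm1 (y i) * pm1 (y' i))).
  by rewrite expr2 invfM; ring.
rewrite card_cubeE -exprVn.
have -> : 2^-1 ^+ n = \prod_(i < n) 2^-1 :> R by rewrite prodr_const card_ord.
rewrite -big_split /=; apply: eq_bigr => i _; rewrite big_bool !noise1E /pm1.
by case: (y i) (y' i) => -[] /=; field.
Qed.

Lemma var_noise t f : var (noise t f) =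
  qform f (fun=> 1) (fun=> expR (- t) ^+ 2) - qform f (fun=> 1) (fun=> 0).
Proof. by rewrite varE// mean_noise_sqr mean_noise sqr_meanE. Qed.

End Spectral.

(** * Random restrictions *)

Section Restriction.
Context {R : realType} {n : nat}.
Implicit Types (f g : cube n -> R) (t : R).

Lemma push_prod2 (w : 'I_n -> bool -> bool -> R) (h : 'I_n -> bool -> bool)
    (F : cube n -> R) :
  \sum_(x : cube n) \sum_(y : cube n) F [ffun i => h i (x i)] *
    F [ffun i => h i (y i)] * (\prod_i w i (x i) (y i)) =
  \sum_(u : cube n) \sum_(v : cube n) F u * F v *
    \prod_i \sum_a \sum_b w i a b * (u i == h i a)%:R * (v i == h i b)%:R.
Proof.
transitivity (\sum_(x : cube n) \sum_(v : cube n) F [ffun i => h i (x i)] *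
    F v * \prod_i \sum_b w i (x i) b * (v i == h i b)%:R).
  apply: eq_bigr => x _.
  have := push_prod (fun i b => w i (x i) b) h F.
  move=> /(congr1 (fun c => F [ffun i => h i (x i)] * c)).
  rewrite !mulr_sumr => E; etransitivity; [|etransitivity; [exact: E|]].
    by apply: eq_bigr => y _; ring.
  by apply: eq_bigr => y _; ring.
rewrite exchange_big [RHS]exchange_big /=; apply: eq_bigr => v _.
have := push_prod (fun i a => \sum_b w i a b * (v i == h i b)%:R) h F.
move=> /(congr1 ( *%R (F v))).
rewrite !mulr_sumr => E; etransitivity; [|etransitivity; [exact: E|]].
  by apply: eq_bigr => y _; ring.
apply: eq_bigr => y _; rewrite mulrCA [F v * _]mulrC [LHS]mulrC; congr (_ * _).
apply: eq_bigr => i _; apply: eq_bigr => a _; rewrite mulr_suml.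
by apply: eq_bigr => b _; ring.
Qed.

(** Per coordinate, a restriction with survival probability [p] keeps the
    kernel with probability [p] and otherwise forces both arguments to a common
    random sign. *)
Lemma mu_qform t f al be :
  \sum_z mu t z * qform (fun x => f (oslash z x)) al be =
  qform f al (fun i => (1 - expR (- t)) * al i + expR (- t) * be i).
Proof.
rewrite qformE.
under eq_bigr => z _.
  rewrite qformE (push_prod2 (fun i a b => al i + be i * (pm1 a * pm1 b))
    (fun i a => if z i is Some b then b else a)) mulrCA.
  rewrite mulr_sumr.
  under eq_bigr => u _ do rewrite mulr_sumr.
  over.
rewrite -mulr_sumr; congr (_ * _).
rewrite exchange_big /=; apply: eq_bigr => u _.
rewrite exchange_big /=; apply: eq_bigr => v _.
under eq_bigr => z _ do rewrite mulrCA -big_split /=.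
rewrite -mulr_sumr; congr (_ * _).
rewrite -(bigA_distr_bigA (fun i c =>
  (if c is Some _ then (1 - expR (- t)) / 2 else expR (- t)) *
  \sum_a \sum_b (al i + be i * (pm1 a * pm1 b)) *
     (u i == if c is Some b0 then b0 else a)%:R *
     (v i == if c is Some b0 then b0 else b)%:R)).
apply: eq_bigr => i _; rewrite sum_optb !big_bool /pm1.
by case: (u i) (v i) => -[] /=; field.
Qed.

Lemma mu_ge0 t (z : tcube n) : 0 <= t -> 0 <= mu t z.
Proof.
move=> t0; apply: prodr_ge0 => i _.
have e0 := expR_ge0 (- t); have e1 : expR (- t) <= 1 by rewrite expR_le1; lra.
by case: (z i) => [_|]; lra.
Qed.

Lemma sum_mu t : \sum_(z : tcube n) mu t z = 1.
Proof.
rewrite -(bigA_distr_bigA (fun (i : 'I_n) (c : option bool) =>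
  if c is Some _ then (1 - expR (- t)) / 2 else expR (- t))).
by rewrite big1// => i _; rewrite sum_optb; field.
Qed.

(** The Fourier weight of [f] on the first level. *)
Definition weight1 f : R := \sum_i mean (fun x => f x * pm1 (x i)) ^+ 2.

(** A character [S] survives on exactly one of its coordinates with probability
    [#|S| * p * (1 - p) ^+ (#|S| - 1)], so a random restriction moves
    Fourier weight from every low level down to the first. *)
Lemma mu_weight1_ge t rho f : 0 <= rho <= 1 - expR (- t) ->
  expR (- t) * (qform f (fun=> 1) (fun=> rho) - qform f (fun=> 1) (fun=> 0)) <=
  \sum_z mu t z * weight1 (fun x => f (oslash z x)).
Proof.
set p := expR (- t) => /andP[rho0 rhop].
have p0 : 0 < p := expR_gt0 _.
under eq_bigr => z _.
  rewrite /weight1 mulr_sumr.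
  under eq_bigr => i _ do rewrite sqr_mean_pm1E.
  over.
rewrite exchange_big /=; under eq_bigr => i _ do rewrite mu_qform -/p.
rewrite /qform exchange_big /= -sumrB mulr_sumr; apply: ler_sum => S _.
rewrite -mulr_suml -mulrBl mulrA ler_wpM2r ?sqr_ge0//.
have c0 (i j : 'I_n) :
    0 <= (if j \in S then (1 - p) * (j != i)%:R + p * (j == i)%:R else (j != i)%:R).
  by case: ifP => _; case: (j == i) => /=; lra.
have [i /= iS|S0] := pickP (mem S); last first.
  have notS j : (j \in S) = false by exact: S0.
  rewrite [X in _ * (X - _)]big1 => [|j _]; last by rewrite notS.
  rewrite [X in _ * (_ - X)]big1 => [|j _]; last by rewrite notS.
  rewrite subrr mulr0.
  by apply: sumr_ge0 => i _; apply: prodr_ge0 => j _; exact: c0.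
(* The event that [i] is the only surviving coordinate of [S] is enough. *)
rewrite [leRHS](bigD1 i)//= -[leLHS]addr0 lerD//; last first.
  by apply: sumr_ge0 => k _; apply: prodr_ge0 => j _; exact: c0.
rewrite [X in _ * (_ - X)](bigD1 i)//= iS mul0r subr0.
rewrite [leLHS](_ : _ = p * \prod_j (if j \in S then rho else 1))//.
rewrite (bigD1 i)//= [leRHS](bigD1 i)//= iS eqxx /= mulr0 mulr1 add0r mulrA.
apply: ler_pM => //.
- by rewrite mulr_ge0// ltW.
- by apply: prodr_ge0 => j _; case: ifP.
- by rewrite -[leRHS]mulr1 ler_wpM2l ?(ltW p0)//; lra.
apply: ler_prod => j ji; rewrite ji (negbTE ji) /=.
by case: ifP => _; lra.
Qed.

End Restriction.

(** * Level-one weight is seen by a half-space *)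

Section HalfspaceCorrelation.
Context {R : realType} {n : nat}.
Implicit Types (A B : {set cube n}).

Lemma maxcov_ge A B : halfspaces R n A -> cov (ind A) (ind B) <= maxcov R B.
Proof.
move=> hA; apply: ub_le_sup; last by exists A.
by exists 1 => _ [C _ <-]; exact: cov_le1.
Qed.

Lemma halfspacesT : halfspaces R n [set: cube n].
Proof.
exists (fun=> 0), 0 => x; rewrite finset.in_setT big1 ?lexx// => i _.
exact: mulr0.
Qed.

Lemma maxcov_le1 B : maxcov R B <= 1.
Proof.
apply: ge_sup; last by move=> _ [C _ <-]; exact: cov_le1.
by exists (cov (ind [set: cube n]) (ind B)); exists [set: cube n] => //; exact: halfspacesT.
Qed.

(** The number of thresholds [1, ..., m] below [v] is the integer part of [v],
    truncated to the range from [0] to [m]. *)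
Lemma threshold_count (v : R) (m : nat) :
  let c : R := \sum_(j < m) (j.+1%:R <= v)%R%:R in
  [/\ 0 <= c <= m%:R, c = 0 \/ c <= v & c = m%:R \/ v <= c + 1].
Proof.
elim: m => [|m [/andP[c0 cm] cv vc]] /=.
  by rewrite big_ord0 lexx; split; [|left|left].
rewrite big_ord_recr /=; set c := \sum_(j < m) _ in c0 cm cv vc *.
rewrite -(natr1 m) in vc cv *.
case: (lerP (m%:R + 1) v) => mv /=.
  have cE : c = m%:R by case: vc => ?; lra.
  by rewrite cE; split; [apply/andP; split; lra|right; lra|left].
rewrite addr0; split=> //; first by apply/andP; split; lra.
by case: vc => ?; right; lra.
Qed.

(** A linear form is a superposition of half-spaces, up to its clipping outside
    [-1/2, 1/2] (paid for by [l ^+ 2 / 2]) and a discretisation at step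
    [m%:R^-1]. *)
Lemma threshold_approx (l : R) (m : nat) : (0 < m)%N ->
  `|l - (m%:R^-1 * \sum_(j < m) (j.+1%:R <= m%:R * (l + 2^-1))%R%:R - 2^-1)|
    <= l ^+ 2 / 2 + m%:R^-1.
Proof.
move=> m0; have mR : 0 < m%:R :> R by rewrite ltr0n.
have [] := threshold_count (m%:R * (l + 2^-1)) m.
set c := \sum_(j < m) _ => /andP[c0 cm] cv vc.
set d := m%:R^-1 * c.
have cE : c = m%:R * d by rewrite /d mulrA mulfV ?mul1r// gt_eqF.
set h := m%:R^-1; have h0 : 0 < h by rewrite invr_gt0.
have hm : m%:R * h = 1 by rewrite mulfV// gt_eqF.
have d0 : 0 <= d by rewrite mulr_ge0// ltW.
have d1 : d <= 1 by rewrite -(ler_pM2l mR) -cE mulr1.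
have sq1 := sqr_ge0 (l + 1); have sq2 := sqr_ge0 (l - 1).
have sq0 := sqr_ge0 l.
have dv : d = 0 \/ d <= l + 2^-1.
  by case: cv => [c00|]; [left; rewrite /d c00 mulr0|rewrite cE ler_pM2l//; right].
have vd : d = 1 \/ l + 2^-1 <= d + h.
  case: vc => [ceq|]; first by left; rewrite /d ceq mulVf// gt_eqF.
  have -> : c + 1 = m%:R * (d + h) by rewrite mulrDr hm -cE.
  by rewrite ler_pM2l//; right.
rewrite ler_norml; apply/andP; split.
  by case: dv => ?; nra.
by case: vd => ?; nra.
Qed.

(** Let [w] be the level-one weight of the indicator of [B].  The form [lin a]
    given by its level-one coefficients has covariance [w] with the indicator,
    and second moment [w].  Replacing it by a combination
    of half-spaces of total mass one costs [w / 2 + 1 / m] by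
    [threshold_approx], and [m] is arbitrary. *)
Lemma half_weight1_le_maxcov B : weight1 (ind B : cube n -> R) / 2 <= maxcov R B.
Proof.
set f : cube n -> R := ind B; set w := weight1 f.
have [a aE] : exists a : 'I_n -> R,
    forall i, a i = mean (fun x : cube n => f x * pm1 (x i)) by eexists.
have waE : \sum_i a i ^+ 2 = w by apply: eq_bigr => i _; rewrite aE.
have wE : mean (fun x => lin a x * (f x - mean f)) = w.
  under eq_mean => x do rewrite mulrBr [_ * mean f]mulrC.
  rewrite meanB meanZ mean_lin mulr0 subr0 /lin.
  under eq_mean => x do rewrite mulr_suml.
  rewrite mean_sum -waE; apply: eq_bigr => i _.
  under eq_mean => x do rewrite [pm1 _ * _]mulrC -mulrA [pm1 _ * _]mulrC.
  by rewrite meanZ -aE -expr2.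
have f_mean x : `|f x - mean f| <= 1.
  have /andP[f0 f1] : 0 <= f x <= 1 by exact: ind_itv.
  have mf0 : 0 <= mean f by apply: mean_ge0 => y; case/andP: (ind_itv B y : 0 <= (_ : R) <= 1).
  have mf1 : mean f <= 1.
    by apply: mean_le_cst => // y; case/andP: (ind_itv B y : 0 <= (_ : R) <= 1).
  by rewrite ler_norml; lra.
have step (m : nat) : (0 < m)%N -> w / 2 <= maxcov R B + m%:R^-1.
  move=> m0; have mR : 0 < m%:R :> R by rewrite ltr0n.
  pose A (j : nat) := [set x : cube n | j.+1%:R <= m%:R * (lin a x + 2^-1)].
  have hA j : halfspaces R n (A j).
    exists (fun i => - a i), (2^-1 - j.+1%:R / m%:R) => x; rewrite inE.
    under eq_bigr => i _ do rewrite mulrN.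
    rewrite sumrN -/(lin a x) -[RHS](ler_pM2l mR) mulrBr [X in _ - X]mulrC divfK ?gt_eqF//.
    by rewrite mulrDr mulrN; apply/idP/idP; lra.
  have covA j : mean (fun x => ind (A j) x * (f x - mean f)) <= maxcov R B.
    apply: le_trans (maxcov_ge B (hA j)); rewrite covE//.
    under eq_mean => x do rewrite mulrBr [_ * mean f]mulrC.
    by rewrite meanB meanZ mulrC.
  have : w <= mean (fun x => m%:R^-1 * (\sum_(j < m) ind (A j) x * (f x - mean f))
      - 2^-1 * (f x - mean f) + (2^-1 * lin a x ^+ 2 + m%:R^-1)).
    rewrite -wE; apply: ler_mean => x.
    have := threshold_approx (lin a x) m0.
    set s := m%:R^-1 * _ => sE.
    have -> : m%:R^-1 * (\sum_(j < m) ind (A j) x * (f x - mean f)) =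
        s * (f x - mean f).
      rewrite -mulr_suml mulrA /s; congr (_ * _ * _).
      by apply: eq_bigr => j _; rewrite /ind inE.
    have := ler_pM (normr_ge0 _) (normr_ge0 _) sE (f_mean x).
    by rewrite -normrM mulr1 => /(le_trans (ler_norm _)); lra.
  rewrite meanD meanB !meanZ meanB mean_cst// subrr mulr0 subr0 mean_sum.
  rewrite meanD meanZ mean_lin_sqr mean_cst// waE => wle.
  have : m%:R^-1 * (\sum_(j < m) mean (fun x => ind (A j) x * (f x - mean f))) <= maxcov R B.
    rewrite -(ler_pM2l mR) mulrA mulfV ?gt_eqF// mul1r.
    apply: (@le_trans _ _ (\sum_(j < m) maxcov R B)).
      by apply: ler_sum => j _; exact: covA.
    by rewrite sumr_const card_ord mulr_natl.
  by rewrite -/f; lra.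
apply/ler_addgt0Pr => e e0.
pose m := (Num.bound e^-1).+1.
apply: le_trans (step m isT) _; rewrite lerD2l -[leRHS]invrK lef_pV2 ?posrE ?invr_gt0//.
apply: le_trans (ltW (archi_boundP _)) _; first by rewrite invr_ge0 ltW.
by rewrite ler_nat.
Qed.

End HalfspaceCorrelation.

(** * Stable sets have correlated restrictions *)

Section StableToCorrelated.
Context {R : realType} {n : nat}.

(** Noise stability leaves weight on low levels, a random restriction moves it
    to level one, and level-one weight is seen by a half-space.  The bound is
    available for every large restriction time [s], which lets one diagonalise
    over noise times. *)
Lemma restr_correlated_noise (t s d : R) (B : {set cube n}) :
  0 <= s -> expR (- t) ^+ 2 <= 1 - expR (- s) -> 0 <= d ->
  d <= var (noise t (ind B)) -> restr_correlated s (expR (- s) * d / 4) B.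
Proof.
move=> s0 ts d0 dv; set p := expR (- s); have p0 : 0 <= p := expR_ge0 _.
set e := p * d / 4; have e0 : 0 <= e by rewrite /e; nra.
have w1le : \sum_z mu s z * weight1 (fun x => ind B (oslash z x)) <=
    \sum_z mu s z * (2 * maxcov R (zrestrict B z)).
  apply: ler_sum => z _; rewrite ler_wpM2l ?mu_ge0//.
  have -> : weight1 (fun x => ind B (oslash z x)) = weight1 (ind (zrestrict B z)) :> R.
    by congr weight1; apply/funext => x; rewrite /ind /zrestrict inE.
  by have := half_weight1_le_maxcov (R := R) (zrestrict B z); lra.
(* Markov's inequality: [maxcov] is at most [1], and at most [e] off the event. *)
have Mle : \sum_z mu s z * (2 * maxcov R (zrestrict B z)) <=
    2 * (mu_prob s (fun z => e <= maxcov R (zrestrict B z)) + e).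
  rewrite [X in _ + X](_ : e = \sum_(z : tcube n) mu s z * e); last first.
    by rewrite -mulr_suml sum_mu mul1r.
  rewrite /mu_prob [X in X + _]big_mkcond -big_split mulr_sumr.
  apply: ler_sum => z _ /=.
  have m0 := mu_ge0 z s0; have M1 := maxcov_le1 (R := R) (zrestrict B z).
  by case: ifPn => [_|]; rewrite -?ltNge; nra.
have := @mu_weight1_ge R n s (expR (- t) ^+ 2) (ind B).
rewrite sqr_ge0 ts -var_noise => /(_ isT).
rewrite -/p in w1le Mle * => w1ge.
have pdv : p * d <= p * var (noise t (ind B)) by nra.
have eE : 4 * e = p * d by rewrite /e; field.
by rewrite /restr_correlated; lra.
Qed.

End StableToCorrelated.

(** * Uniform noise stability of half-spaces *)

Section HalfspaceStability.
Context {R : realType}.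

Lemma mean_swap (S T : finType) (F : S -> T -> R) :
  mean (fun x => mean (F x)) = mean (fun y => mean (fun x => F x y)).
Proof.
rewrite /mean -!mulr_suml exchange_big /=.
by rewrite mulrAC.
Qed.

Lemma lin_flip m (w : 'I_m -> R) (j : 'I_m) (s : cube m) :
  lin w (flip (pred1 j) s) = lin w s - 2 * (pm1 (s j) * w j).
Proof.
rewrite /lin (bigD1 j)//= [in RHS](bigD1 j)//= ffunE /= eqxx.
under eq_bigr => i /negbTE ij do rewrite ffunE /= ij addbF.
by rewrite pm1M [pm1 true]/pm1 expr1; ring.
Qed.

(** Crossing a half-space boundary along coordinate [j] always happens in the
    direction given by the sign of [w j], so the total influence is [-2] times
    the mean of the half-space against a sum of [m] orthonormal signs, and is at
    most [2 * sqrt m]; the parameter [k] stands for [sqrt m]. *)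
Lemma halfspace_influence m (w : 'I_m -> R) (b k : R) : 0 < k -> m%:R = k ^+ 2 ->
  mean (fun s : cube m => \sum_j
    `|(lin w s <= b)%R%:R - (lin w (flip (pred1 j) s) <= b)%R%:R|) <= 2 * k.
Proof.
move=> k0 mk.
pose g (s : cube m) : R := (lin w s <= b)%R%:R.
pose sg j : R := if 0 <= w j then 1 else -1.
have term j (s : cube m) : `|g s - g (flip (pred1 j) s)| =
    sg j * pm1 (s j) * (g (flip (pred1 j) s) - g s).
  rewrite /g lin_flip /sg /pm1.
  case: (lerP 0 (w j)) => w0; case: (s j); rewrite /= ?expr1 ?expr0;
  case: (lerP (lin w s) b) => h1; case: lerP => h2 /=;
  rewrite ?subrr ?normr0 ?sub0r ?subr0 ?normrN ?normr1; (try lra); nra.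
have -> : mean (fun s : cube m => \sum_j `|g s - g (flip (pred1 j) s)|) =
    mean (fun s => -2 * g s * lin sg s).
  rewrite mean_sum.
  under eq_bigr => j _.
    under eq_mean => s do rewrite term mulrBr.
    rewrite meanB -(mean_flip (pred1 j)).
    under eq_mean => s do rewrite flipK ffunE /= eqxx pm1M.
    rewrite -meanB.
    over.
  rewrite -mean_sum; apply: eq_mean => s.
  rewrite /lin mulr_sumr; apply: eq_bigr => j _.
  by rewrite [pm1 true]/pm1 expr1; ring.
have sgE : mean (fun s => k^-1 * lin sg s ^+ 2) = k.
  rewrite meanZ mean_lin_sqr.
  rewrite (eq_bigr (fun=> 1)) => [|j _]; last first.
    by rewrite /sg; case: ifP => _; rewrite ?sqrrN expr1n.
  by rewrite sumr_const card_ord mk; field; rewrite gt_eqF.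
(* [- 2 * y <= y ^+ 2 / k + k], where [k] balances the two means. *)
apply: (@le_trans _ _ (mean (fun s => k^-1 * lin sg s ^+ 2 + k))); last first.
  by rewrite meanD sgE mean_cst//; lra.
apply: ler_mean => s.
have kk : k * k^-1 = 1 by rewrite mulfV// gt_eqF.
have k'0 : 0 < k^-1 by rewrite invr_gt0.
have : 0 <= k^-1 * (lin sg s + k) ^+ 2 by rewrite mulr_ge0 ?sqr_ge0// ltW.
have : 0 <= k^-1 * lin sg s ^+ 2 by rewrite mulr_ge0 ?sqr_ge0// ltW.
have -> : k^-1 * (lin sg s + k) ^+ 2 =
    k^-1 * lin sg s ^+ 2 + (k * k^-1) * (2 * lin sg s + k) by ring.
rewrite kk /g; case: (_ <= b) => /=; lra.
Qed.

(** Assigning each coordinate to one of [m] blocks uniformly at random and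
    flipping the block [j] is noise: every coordinate flips independently with
    probability [1 / m]. *)
Lemma noise_kernel_block n m (j : 'I_m) (u : R) (x : cube n) (F : cube n -> R) :
  expR (- u) = 1 - 2 / m%:R ->
  \sum_y noise_kernel u x y * F y =
  mean (fun q : {ffun 'I_n -> 'I_m} => F (flip (fun i => q i == j) x)).
Proof.
move=> um; have m0 : m%:R != 0 :> R by rewrite pnatr_eq0 -lt0n (leq_trans _ (ltn_ord j)).
have := @push_prod R n 'I_m bool (fun _ _ => m%:R^-1) (fun i k => x i (+) (k == j)) F.
rewrite /mean card_ffun !card_ord natrX -exprVn mulr_suml => E.
symmetry; etransitivity; last (etransitivity; first exact: E).
  by apply: eq_bigr => q _; rewrite prodr_const card_ord mulrC.
apply: eq_bigr => y _; congr (_ * _); apply: eq_bigr => i _.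
rewrite -mulr_sumr noise1E um.
have sj : \sum_(k < m) (k == j)%:R = 1 :> R.
  by rewrite (bigD1 j)//= eqxx big1 ?addr0// => k /negbTE->.
rewrite (eq_bigr (fun k : 'I_m => if y i == x i then 1 - (k == j)%:R else (k == j)%:R)).
  case: eqVneq => [->|yx].
    by rewrite sumrB sj sumr_const card_ord pm1_sqr; field.
  rewrite sj; have -> : pm1 (x i) * pm1 (y i) = -1 :> R.
    by case: (x i) (y i) yx => -[] //= _; rewrite /pm1 expr1 expr0; ring.
  by field.
by move=> k _; case: (y i) (x i) (k == j) => -[] [] /=; ring.
Qed.

(** Peres's argument: randomising the signs of whole blocks turns noise on the
    half-space into the average influence of a random half-space in dimension
    [m = k ^ 2]. *)
Lemma halfspace_noise n (A : {set cube n}) (k : nat) (u : R) :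
  halfspaces R n A -> (0 < k)%N -> expR (- u) = 1 - 2 / (k ^ 2)%:R ->
  mean (fun x => \sum_y noise_kernel u x y * `|ind A x - ind A y|) <= 2 / k%:R.
Proof.
move=> [a [b hA]] k0 um; set m := (k ^ 2)%N in um.
have kR : 0 < k%:R :> R by rewrite ltr0n.
have mR : m%:R = k%:R ^+ 2 :> R by rewrite natrX.
set D := mean _.
pose Phi (j : 'I_m) (q : {ffun 'I_n -> 'I_m}) (s : cube m) (x : cube n) : R :=
  `|ind A (flip (fun i => s (q i)) x) - ind A (flip (fun i => flip (pred1 j) s (q i)) x)|.
(* The block [j] alone realises the noise; first applying the uniform signs [s]
   to all the blocks leaves the law of [x] unchanged. *)
have DE (j : 'I_m) : D = mean (fun q => mean (fun x => mean (fun s => Phi j q s x))).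
  under eq_mean => q.
    rewrite mean_swap.
    under eq_mean => s.
      rewrite (_ : mean _ = mean (fun x => `|ind A x - ind A (flip (fun i => q i == j) x)|)).
        over.
      rewrite -[RHS](mean_flip (fun i => s (q i))); apply: eq_mean => x.
      congr `|_ - ind A _|; apply/ffunP => i; rewrite !ffunE /=.
      by rewrite addbA.
    rewrite mean_cst//.
    over.
  rewrite mean_swap; apply: eq_mean => x; exact: noise_kernel_block.
have : m%:R * D <= 2 * k%:R.
  rewrite -[m in m%:R]card_ord mulr_natl -sumr_const.
  rewrite (eq_bigr _ (fun j _ => DE j)) -mean_sum.
  apply: mean_le_cst => [|q].
    by rewrite card_ffun !card_ord expn_gt0 expn_gt0 k0.
  rewrite -mean_sum; apply: mean_le_cst => // x; rewrite -mean_sum.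
  (* With [x] and the blocks fixed, membership is a half-space in the signs [s]
     of the blocks, the weight of a block being its signed sum. *)
  pose w (j : 'I_m) : R := \sum_(i | q i == j) pm1 (x i) * a i.
  have AE (s : cube m) : ind A (flip (fun i => s (q i)) x) = (lin w s <= b)%R%:R :> R.
    rewrite /ind hA /lin; congr (_ <= _)%R%:R.
    rewrite (partition_big q xpredT)//=; apply: eq_bigr => j _.
    rewrite /w mulr_sumr; apply: eq_bigr => i /eqP<-.
    by rewrite ffunE pm1M; ring.
  apply: le_trans (halfspace_influence w b kR mR); apply: ler_mean => s.
  by apply: ler_sum => j _; rewrite /Phi !AE.
rewrite mR => mD; rewrite -(ler_pM2l (exprn_gt0 2 kR)); apply: le_trans mD _.
by rewrite expr2 mulrCA -mulrA mulfV ?gt_eqF// mulr1.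
Qed.

End HalfspaceStability.

(** * Sets with correlated restrictions are stable *)

Section CorrelatedToStable.
Context {R : realType}.

Lemma cov_noise_halfspace n (A : {set cube n}) (g : cube n -> R) (k : nat) (u : R) :
  halfspaces R n A -> (forall x, 0 <= g x <= 1) -> (0 < k)%N -> 0 <= u ->
  expR (- u) = 1 - 2 / (k ^ 2)%:R ->
  cov (ind A) g <= cov (ind A) (noise u g) + 2 / k%:R.
Proof.
move=> hA g01 k0 u0 um.
rewrite !covE// mean_noise addrAC lerD2r -lerBlDl -meanB.
apply: le_trans (halfspace_noise hA k0 um).
rewrite /mean ler_wpM2r ?invr_ge0//.
have -> : \sum_x (ind A x * g x - ind A x * noise u g x) =
    \sum_x \sum_y noise_kernel u x y * (ind A y - ind A x) * g y.
  rewrite sumrB.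
  have -> : \sum_x ind A x * g x = \sum_x \sum_y noise_kernel u x y * ind A y * g y.
    rewrite exchange_big; apply: eq_bigr => y _ /=.
    by rewrite -!mulr_suml sum_noise_kernel mul1r.
  rewrite -sumrB; apply: eq_bigr => x _.
  rewrite /noise mulr_sumr -sumrB; apply: eq_bigr => y _.
  by rewrite -/(noise_kernel _ _ _); ring.
apply: ler_sum => x _; apply: ler_sum => y _.
rewrite -mulrA ler_wpM2l ?noise_kernel_ge0//.
have /andP[g0 g1] := g01 y.
have := ler_norm (ind A y - ind A x : R); have := normr_ge0 (ind A y - ind A x : R).
by rewrite distrC; nra.
Qed.

Lemma var_ind_le1 n (A : {set cube n}) : var (ind A) <= 1 :> R.
Proof. exact: cov_le1. Qed.

(** Half-spaces are stable under noise uniformly in the dimension, so the part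
    of [g] correlated with one survives the noise. *)
Lemma var_noise_ge_of_cov (e : R) : 0 < e -> exists2 u : R, 0 < u &
  forall n (A : {set cube n}) (g : cube n -> R), halfspaces R n A ->
    (forall x, 0 <= g x <= 1) -> e <= cov (ind A) g -> e ^+ 2 / 4 <= var (noise u g).
Proof.
move=> e0.
have [k1 k1e] := ltr_add_invr (divr_gt0 e0 (ltr0n R 4)).
have [k k_gt1 ke] : exists2 k, (1 < k)%N & 2 / k%:R <= e / 2.
  exists k1.+2 => //.
  rewrite (_ : e / 2 = 2 * (e / 4)); last by field.
  rewrite ler_pM2l// (@le_trans _ _ k1.+1%:R^-1)//.
    by rewrite lef_pV2 ?posrE ?ltr0n// ler_nat.
  by rewrite add0r in k1e; exact: ltW.
have k0 : (0 < k)%N by exact: ltnW.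
set rho : R := 1 - 2 / (k ^ 2)%:R.
have /andP[rho0 rho1] : 0 < rho < 1.
  have k4 : 2 < (k ^ 2)%:R :> R.
    by rewrite ltr_nat (@leq_trans (2 ^ 2)) ?leq_exp2r.
  have kk : 0 < (k ^ 2)%:R :> R by exact: lt_trans k4.
  apply/andP; split; first by rewrite subr_gt0 ltr_pdivrMr// mul1r.
  by rewrite ltrBlDr ltrDl divr_gt0.
exists (- ln rho); first by rewrite oppr_gt0 ln_lt0// rho0.
set u := - _ => n A g hA g01 eA.
have u0 : 0 <= u by rewrite oppr_ge0 ln_le0// ltW.
have um : expR (- u) = rho by rewrite opprK lnK.
have := cov_noise_halfspace hA g01 k0 u0 um.
have := cov_le_var (ind A) (noise u g) (e / 2).
by have := @var_ind_le1 n A; nra.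
Qed.

Lemma var_ge0 (T : finType) (f : T -> R) : 0 <= var f.
Proof. by apply: mean_ge0 => x; rewrite -expr2 sqr_ge0. Qed.

(** Averaging over the restriction composes it with the noise: in the second
    moment a coordinate is common to the two copies with probability [1 - p] and
    exposed to the noise [u] otherwise, which is the noise [s].  The subtracted
    terms compare because the restricted means have second moment at least
    [mean f ^+ 2]. *)
Lemma mu_var_noise_le n (t u s : R) (f : cube n -> R) : 0 <= t ->
  expR (- s) ^+ 2 = 1 - expR (- t) + expR (- t) * expR (- u) ^+ 2 ->
  \sum_z mu t z * var (noise u (fun x => f (oslash z x))) <= var (noise s f).
Proof.
move=> t0 su.
under eq_bigr => z _ do rewrite var_noise mulrBr.
rewrite sumrB !mu_qform var_noise su.
have p1 : expR (- t) <= 1 by rewrite expR_le1; lra.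
apply: lerB.
  rewrite le_eqVlt; apply/orP; left; apply/eqP; congr qform.
  by apply/funext => i; rewrite mulr1.
by apply: qform_le => i; rewrite ?ler01// lexx mulr1 mulr0 addr0 subr_ge0.
Qed.

Lemma var_noise_restr_correlated (t e : R) : 0 < t -> 0 < e ->
  exists s c : R, [/\ 0 < s, 0 < c & forall n (B : {set cube n}),
    restr_correlated t e B -> c <= var (noise s (ind B))].
Proof.
move=> t0 e0; have e20 : 0 < e / 2 by lra.
have [u u0 uP] := var_noise_ge_of_cov e20.
set c0 := (e / 2) ^+ 2 / 4 in uP.
have c00 : 0 < c0 by rewrite divr_gt0// exprn_gt0.
pose r := 1 - expR (- t) + expR (- t) * expR (- u) ^+ 2.
have p0 := expR_gt0 (- t); have p1 : expR (- t) < 1 by rewrite expR_lt1; lra.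
have q0 := expR_gt0 (- u); have q1 : expR (- u) < 1 by rewrite expR_lt1; lra.
have q2 : 0 < expR (- u) ^+ 2 < 1 by rewrite exprn_gt0// expr_lt1// ltW.
have r01 : 0 < r < 1.
  by case/andP: q2 => q20 q21; rewrite /r; apply/andP; split; nra.
case/andP: r01 => r0 r1.
pose s := - ln r / 2.
have s0 : 0 < s by rewrite divr_gt0// oppr_gt0 ln_lt0// r0.
have sE : expR (- s) ^+ 2 = r.
  rewrite -expRM_natl (_ : _ * _ = ln r) ?lnK//.
  by rewrite /s; field.
exists s, (c0 * e); split=> //; first exact: mulr_gt0.
move=> n B BP; apply: le_trans (mu_var_noise_le (ind B) (ltW t0) sE).
apply: (@le_trans _ _ (c0 * mu_prob t (fun z => e <= maxcov R (zrestrict B z)))).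
  by rewrite ler_pM2l.
rewrite /mu_prob mulr_sumr big_mkcond; apply: ler_sum => z _.
case: ifPn => [eM|_]; last by rewrite mulr_ge0 ?mu_ge0 ?(ltW t0)// var_ge0.
rewrite mulrC ler_wpM2l ?mu_ge0 ?(ltW t0)//.
have -> : (fun x => ind B (oslash z x)) = ind (zrestrict B z) :> (_ -> R).
  by apply/funext => x; rewrite /ind /zrestrict inE.
(* The supremum is only approached, so [e] is lowered to [e / 2]. *)
have [||_ [A hA <-] eA] := @sup_gt R [set cov (ind A) (ind (zrestrict B z)) |
    A in halfspaces R n]%classic (e / 2).
- exists (cov (ind [set: cube n]) (ind (zrestrict B z))).
  by exists [set: cube n] => //; exact: halfspacesT.
- by apply: lt_le_trans eM; lra.
apply: uP hA _ (ltW eA) => x; exact: ind_itv.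
Qed.

End CorrelatedToStable.

(** * Sequences of sets *)

Lemma cvg_to0P (R : realType) (v : nat -> R) : (forall k, 0 <= v k) ->
  (v @ \oo --> (0 : R))%classic <->
  (forall d, 0 < d -> exists N, forall k, (N <= k)%N -> v k < d).
Proof.
move=> v0; split=> [v_cvg d d0|vP].
  have [N _ NP] := (cvgr0Pnorm_lt v).1 v_cvg d d0.
  exists N => k Nk; have := NP k Nk.
  by rewrite /= ger0_norm.
apply/cvgr0Pnorm_lt => d d0; have [N NP] := vP d d0.
by exists N => // k /= Nk; rewrite ger0_norm//; exact: NP.
Qed.

Section Sequences.
Context {R : realType}.

Lemma noise_sensitiveP (n : nat -> nat) (B : forall i, {set cube (n i)}) :
  noise_sensitive R B <-> forall t d : R, 0 < t -> 0 < d ->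
    exists N, forall k, (N <= k)%N -> var (noise t (ind (B k))) < d.
Proof.
split=> [sensB t d t0 d0|sensB t t0].
  by apply: (cvg_to0P _).1 (sensB t t0) d d0 => k; exact: var_ge0.
by apply/cvg_to0P => [k|d d0]; [exact: var_ge0|exact: sensB].
Qed.

Lemma expRN_le_inv (k : nat) : expR (- k.+1%:R) <= k.+1%:R^-1 :> R.
Proof.
rewrite expRN lef_pV2 ?posrE ?expR_gt0// (le_trans _ (expR_ge1Dx _))//.
by rewrite lerDr.
Qed.

Lemma noise_time_gap (t : R) : 0 < t -> 0 < 1 - expR (- t) ^+ 2 < 1.
Proof.
move=> t0; have e0 := expR_gt0 (- t).
have e1 : expR (- t) < 1 by rewrite expR_lt1; lra.
by apply/andP; split; nra.
Qed.

End Sequences.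

(* Noise stability, being the negation of noise sensitivity, says something
   about infinitely many terms only: if B i is a dictator for even i and empty
   for odd i, the sequence is noise stable, but no condition on random
   restrictions holds for all large i.  Hence the two equivalences: stability
   matches the condition for infinitely many i, and stability of every
   subsequence matches the condition for all sufficiently large i. *)
Theorem theorem1p1 (R : realType) (n : nat -> nat) (n_gt0 : forall i, (0 < n i)%N)
    (B : forall i, {set cube (n i)}) :
  (noise_stable R B <->
     exists t eps : R, [/\ 0 < t, 0 < eps &
       forall N : nat, exists2 i, (N <= i)%N & restr_correlated t eps (B i)])
  /\
  ((forall phi : nat -> nat, {homo phi : i j / (i < j)%N} ->
      noise_stable R (fun k => B (phi k))) <->
     exists t eps : R, [/\ 0 < t, 0 < eps &
       \forall i \near \oo%classic, restr_correlated t eps (B i)]).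
Proof.
split; split.
- move=> /noise_sensitiveP; rewrite -existsNE => -[t].
  rewrite -existsNE => -[d] /not_implyP[t0] /not_implyP[d0] notN.
  have /andP[r0 r1] := noise_time_gap t0; set r := 1 - _ in r0 r1.
  (* The restriction time at which a coordinate dies with probability
     [exp (- 2 t)]. *)
  have s0 : 0 < - ln r by rewrite oppr_gt0 ln_lt0// r0.
  have sE : expR (- - ln r) = r by rewrite opprK lnK.
  exists (- ln r), (expR (- - ln r) * d / 4); split=> //.
    by rewrite sE divr_gt0// mulr_gt0.
  move=> N; apply: contrapT => noi; apply: notN; exists N => i Ni.
  rewrite ltNge; apply/negP => dv; apply: noi; exists i => //.
  apply: (restr_correlated_noise (ltW s0) _ (ltW d0) dv).
  by rewrite sE /r; lra.
- move=> [t [e [t0 e0 corr]]] /noise_sensitiveP sensB.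
  have [s [c [s0 c0 sc]]] := var_noise_restr_correlated t0 e0.
  have [N NP] := sensB s c s0 c0; have [i Ni /sc] := corr N.
  by rewrite leNgt NP.
- move=> stab; apply: contrapT => nocorr.
  (* [T k] tends to infinity, so it is eventually large enough for any noise
     time in [restr_correlated_noise], whose conclusion has parameter [E k] when
     the variance is at least [(T k)^-1]. *)
  pose T (k : nat) : R := k.+1%:R; pose E k : R := expR (- T k) * (T k)^-1 / 4.
  have T0 k : 0 < T k by rewrite ltr0n.
  have E0 k : 0 < E k by rewrite divr_gt0// mulr_gt0 ?expR_gt0// invr_gt0.
  have /choice[G GP] (Nk : nat * nat) : exists i, (Nk.1 <= i)%N /\
      ~ restr_correlated (T Nk.2) (E Nk.2) (B i).
    case: Nk => N k /=; apply: contrapT => noi; apply: nocorr.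
    exists (T k), (E k); split=> //; exists N => // i /= Ni.
    by apply: contrapT => nri; apply: noi; exists i.
  pose fix phi (k : nat) : nat :=
    if k is k'.+1 then G ((phi k').+1, k) else G (0, 0)%N.
  have phiP k : ~ restr_correlated (T k) (E k) (B (phi k)).
    by case: k => [|k]; exact: (GP (_, _)).2.
  have phi_homo : {homo phi : i j / (i < j)%N}.
    apply: homo_ltn => [|k]; first exact: ltn_trans.
    exact: (GP (_, _)).1.
  apply: (stab phi phi_homo); apply/noise_sensitiveP => t d t0 d0.
  have /andP[r0 _] := noise_time_gap t0.
  have [N1 N1P] := ltr_add_invr d0; have [N2 N2P] := ltr_add_invr r0.
  rewrite !add0r in N1P N2P.
  have invT N k : (N <= k)%N -> (T k)^-1 <= N.+1%:R^-1.
    by move=> Nk; rewrite lef_pV2 ?posrE// ler_nat.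
  exists (maxn N1 N2) => k; rewrite geq_max => /andP[N1k N2k].
  rewrite ltNge; apply/negP => dv; apply: (phiP k).
  apply: (@restr_correlated_noise _ _ t) => //.
  + have := le_trans (expRN_le_inv k) (le_trans (invT _ _ N2k) (ltW N2P)).
    by rewrite -/(T k); lra.
  + by rewrite invr_ge0 (ltW (T0 k)).
  + exact: le_trans (invT _ _ N1k) (le_trans (ltW N1P) dv).
- move=> [t [e [t0 e0 [N _ NP]]]] phi phi_homo /noise_sensitiveP sensB.
  have [s [c [s0 c0 sc]]] := var_noise_restr_correlated t0 e0.
  have [M MP] := sensB s c s0 c0.
  have phi_ge k : (k <= phi k)%N.
    by elim: k => // k /leq_ltn_trans; apply; exact: phi_homo.
  have /sc : restr_correlated t e (B (phi (maxn N M))).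
    by apply: NP => /=; apply: leq_trans (phi_ge _); exact: leq_maxl.
  by rewrite leNgt MP// leq_maxr.
Qed.
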